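(* Let $D$ be a connected strongly graded $S$-ring, $z\in D^1$ a central element and $A:=D/zD$. Suppose that $A^1$ is projective as a left $S$-module. Let $(M_*,\delta_* )$ be the sequence of graded left $D$-modules and maps associated to $z$ and to a chosen projective resolution $(A\otimes V_*,d_* )$ of $S$ as described in the context. The following assertions are equivalent. (1) The element $z$ is regular. (2) The sequence $(M_*,\delta_* )$ is a resolution of $S$ by projective left $D$-modules. (3) The sequence $({}^2M_*,\delta_* )$ is a complex and $\mathrm H_1({}^1M_* )=0$.
   Context: $S$ is an associative unital ring, $\otimes=\otimes_S$. A positively graded $S$-ring $D=\bigoplus_{n\ge0}D^n$ is connected if $D^0=S$ and strongly graded if $D^nD^m=D^{n+m}$. Shift: $X(d)^n=X^{n+d}$. Let $\pi:D\to A=D/zD$ be the projection (so $A^0=S$). $\operatorname{ann}(z)=\{a\in D\mid za=0\}$. The element $z$ is $n$-regular if $\operatorname{ann}(z)\cap D^{\le n}=0$, and regular if it is $n$-regular for all $n$ (i.e. $\operatorname{ann}(z)=0$). Resolution: one fixes a projective resolution of the left $A$-module $S$ $$\cdots\to A\otimes V_n\xrightarrow{d_n}A\otimes V_{n-1}\to\cdots\to A\otimes V_2\xrightarrow{d_2}A\otimes A^1\xrightarrow{d_1}A\xrightarrow{d_0}S\to0$$ where $V_0=S$, $V_1=A^1$ (in degree 1), the $V_n$ are graded projective left $S$-modules, the $d_n$ are graded $A$-linear maps, $d_0$ is the projection onto $A^0=S$, $d_1$ is induced by multiplication, and $V_n^i=0$ for $n\ge2$ and $i=0,1$. (Such resolutions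 exist.) Construction: put $N_n:=D\otimes V_n$, $N_{-1}=0$, $M_n:=N_n\oplus N_{n-1}(-1)$ (so $M_0=D$). Let $\partial_0:D\to S$ be the canonical projection and, for $n\ge1$, choose a graded $D$-linear $\partial_n:N_n\to N_{n-1}$ with $(\pi\otimes V_{n-1})\partial_n=d_n(\pi\otimes V_n)$; $\partial_1$ is chosen as $\partial_1(x\otimes a)=x\sigma^1(a)$ with $\sigma^1:A^1\to D^1$ a left $S$-linear section of $\pi^1$. For $n\ge2$ choose a graded $D$-linear $f_n:N_n\to N_{n-2}(-1)$ with $\partial_{n-1}\partial_n=(-1)^{n-1}z\cdot f_n$. Define $\delta_0:D\to S$ as the canonical projection, $\delta_1(x,y)=\partial_1(x)+zy$, and for $n\ge2$ $$\delta_n(x,y)=\big(\partial_n(x)+(-1)^{n-1}zy,\ \partial_{n-1}(y)+f_n(x)\big),\qquad (x,y)\in M_n .$$ In general $\delta_n\delta_{n+1}$ need not vanish. ${}^pM_*$ denotes the truncated sequence $M_{p+1}\xrightarrow{\delta_{p+1}}M_p\to\cdots\xrightarrow{\delta_1}M_0\to0$; ${}^1M_*$ is always a complex, and $\mathrm H_1({}^1M_* )=\ker\delta_1/\operatorname{im}\delta_2$. *)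

(* Defs.v *)
From HB Require Import structures.
From mathcomp Require Import all_boot all_order all_algebra.
From mathcomp Require Import ring_quotient generic_quotient.
From mathcomp Require Import boolp classical_sets.
From mathcomp.multinomials Require Import freeg.

Set Implicit Arguments.
Unset Strict Implicit.
Unset Printing Implicit Defensive.

Import GRing.Theory.
Local Open Scope ring_scope.
Local Open Scope quotient_scope.

Inductive zspan (X : zmodType) (G : set X) : set X :=
| zspan_gen x : G x -> zspan G x
| zspan0 : zspan G 0
| zspanB x y : zspan G x -> zspan G y -> zspan G (x - y).

Section ZSpan.
Variables (X : zmodType) (G : set X).

Definition zspan_pred : {pred X} := fun x => `[< zspan G x >].

Lemma zspan_predP x : reflect (zspan G x) (x \in zspan_pred).
Proof. exact: asboolP. Qed.

Fact zspan_pred_closed : zmod_closed zspan_pred.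
Proof.
split; first by apply/zspan_predP; exact: zspan0.
by move=> x y /zspan_predP Gx /zspan_predP Gy; apply/zspan_predP; exact: zspanB.
Qed.

HB.instance Definition _ :=
  GRing.isZmodClosed.Build X zspan_pred zspan_pred_closed.

Lemma zspan_sub (P : set X) :
  (forall x, G x -> P x) -> P 0 -> (forall x y, P x -> P y -> P (x - y)) ->
  forall x, zspan G x -> P x.
Proof. by move=> PG P0 PB x; elim=> // *; try exact: PG; exact: PB. Qed.
End ZSpan.

Lemma quot_eq0 (X : zmodType) (I : zmodClosed X) (x : X) :
  \pi_(Quotient.quot I) x = 0 <-> x \in I.
Proof.
have -> : (0 : Quotient.quot I) = \pi 0 by rewrite piE.
by rewrite -[x in x \in I]subr0 Quotient.idealrBE; split=> [->|/eqP].
Qed.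

Section RestrictionOfScalars.
Variables (R R' : pzRingType) (f : {rmorphism R -> R'}) (X : lmodType R').

(* [X], seen as an [R]-module through [f] *)
Definition resmod of {rmorphism R -> R'} : Type := X.
Local Notation T := (resmod f).

HB.instance Definition _ := GRing.Zmodule.on T.

Let scale (r : R) (x : T) : T := f r *: (x : X).

Fact resmod_scaleA a b x : scale a (scale b x) = scale (a * b) x.
Proof. by rewrite /scale scalerA rmorphM. Qed.
Fact resmod_scale1 : left_id 1 scale.
Proof. by move=> x; rewrite /scale rmorph1 scale1r. Qed.
Fact resmod_scaleDr : right_distributive scale +%R.
Proof. by move=> a x y; rewrite /scale scalerDr. Qed.
Fact resmod_scaleDl x : {morph scale^~ x : a b / a + b}.
Proof. by move=> a b; rewrite /scale rmorphD scalerDl. Qed.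

HB.instance Definition _ := GRing.Zmodule_isLmodule.Build R T
  resmod_scaleA resmod_scale1 resmod_scaleDr resmod_scaleDl.
End RestrictionOfScalars.

Arguments resmod {R R'} X f.

Definition projective (R : pzRingType) (P : lmodType R) : Prop :=
  forall (X Y : lmodType R) (g : {linear X -> Y}) (h : {linear P -> Y}),
    (forall y, exists x, g x = y) ->
    exists k : {linear P -> X}, forall p, g (k p) = h p.

Definition exact_at (X Y Z : zmodType) (f : X -> Y) (g : Y -> Z) : Prop :=
  forall y, g y = 0 <-> exists x, f x = y.

(* $\ker g / \operatorname{im} f$; nothing requires $g f = 0$, so one divides
   by $\operatorname{im} f \cap \ker g$. *)
Section Homology.
Variables (X Y Z : zmodType) (f : {additive X -> Y}) (g : {additive Y -> Z}).

Definition ker_pred : {pred Y} := fun y => g y == 0.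

Fact ker_pred_closed : zmod_closed ker_pred.
Proof.
split=> [|x y]; rewrite !unfold_in ?raddf0 // => /eqP gx /eqP gy.
by rewrite raddfB gx gy subrr.
Qed.

HB.instance Definition _ := GRing.isZmodClosed.Build Y ker_pred ker_pred_closed.

Record ker : Type := Ker { ker_val : Y; _ : ker_val \in ker_pred }.

HB.instance Definition _ := [isSub for ker_val].
HB.instance Definition _ := [Choice of ker by <:].
HB.instance Definition _ := [SubChoice_isSubZmodule of ker by <:].

Definition im_pred : {pred ker} := fun y => `[< exists x, f x = ker_val y >].

Fact im_pred_closed : zmod_closed im_pred.
Proof.
split; first by apply/asboolP; exists 0; rewrite raddf0.
move=> x y /asboolP[a ax] /asboolP[b bx]; apply/asboolP; exists (a - b).
by rewrite raddfB ax bx.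
Qed.

HB.instance Definition _ := GRing.isZmodClosed.Build ker im_pred im_pred_closed.

Definition homology : zmodType := Quotient.quot im_pred.

Lemma homology_eq0 : (forall h : homology, h = 0) <->
  (forall y, g y = 0 -> exists x, f x = y).
Proof.
split=> [H0 y /eqP gy | H0 h].
  have := H0 (\pi_(Quotient.quot im_pred) (Ker gy)).
  by move/quot_eq0/asboolP.
rewrite -[h]reprK; apply/quot_eq0/asboolP; apply: H0.
by case: (repr h) => y /= /eqP.
Qed.
End Homology.

Section Sequences.
Variables (R : pzRingType) (M : nat -> lmodType R).
Variable (d : forall n, {linear M n.+1 -> M n}).

Definition resolution (T : lmodType R) (e : {linear M 0 -> T}) : Prop :=
  [/\ (forall t, exists x, e x = t), exact_at (d 0) e
    & forall n, exact_at (d n.+1) (d n)].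

Definition projective_resolution (T : lmodType R) (e : {linear M 0 -> T}) :=
  (forall n, projective (M n)) /\ resolution e.

(* With [d n] the map written $d_{n+1}$ on paper, the truncation
   $M_{p+1} \to M_p \to \dots \to M_0 \to 0$ is a complex. *)
Definition trunc_complex (p : nat) : Prop :=
  forall n, (n < p)%N -> forall x, d n (d n.+1 x) = 0.
End Sequences.

Definition set_subgroup (X : zmodType) (P : set X) : Prop :=
  P 0 /\ forall x y, P x -> P y -> P (x - y).

(* [X] is the internal direct sum of the additive subgroups [G n] *)
Record is_grading (X : zmodType) (G : nat -> set X) : Prop := IsGrading {
  grading_zmod : forall n, set_subgroup (G n);
  grading_span : forall x, exists c : nat -> X, exists N : nat,
    (forall n, G n (c n)) /\ x = \sum_(n < N) c n;
  grading_free : forall (c : nat -> X) (N : nat),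
    (forall n, G n (c n)) -> \sum_(n < N) c n = 0 ->
    forall n, (n < N)%N -> c n = 0
}.

(* The shift $X(-1)$, with $X(-1)^n = X^{n-1}$ and $X^{-1} = 0$ *)
Definition shiftN1 (X : zmodType) (G : nat -> set X) (n : nat) : set X :=
  if n is m.+1 then G m else [set 0]%classic.

Definition graded_map (X Y : zmodType) (GX : nat -> set X) (GY : nat -> set Y)
  (f : X -> Y) : Prop := forall n x, GX n x -> GY n (f x).

Record gradedMod (S : pzRingType) := GradedMod {
  gmod :> lmodType S;
  gmdeg : nat -> set gmod;
  gmdeg_grading : is_grading gmdeg;
  gmdeg_scale : forall n (s : S) x, gmdeg n x -> gmdeg n (s *: x)
}.

(* Positively graded connected [S]-rings: $D^0 = S$ via [gincl] *)
Record connRing (S : pzRingType) := ConnRing {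
  cring :> pzRingType;
  gincl : {rmorphism S -> cring};
  gdeg : nat -> set cring;
  gdeg_grading : is_grading gdeg;
  gdeg1 : gdeg 0 1;
  gdegM : forall m n x y, gdeg m x -> gdeg n y -> gdeg (m + n) (x * y);
  gincl_inj : injective gincl;
  gincl_range : forall x, gdeg 0 x <-> exists s, gincl s = x
}.

Definition strongly_graded (S : pzRingType) (D : connRing S) : Prop :=
  forall m n : nat, gdeg (c := D) (m + n) =
    zspan [set p | exists x y, [/\ gdeg m x, gdeg n y & p = x * y]].

Definition gdeg_le (S : pzRingType) (D : connRing S) (n : nat) : set D :=
  [set x | exists c : nat -> D,
    (forall i, gdeg i (c i)) /\ x = \sum_(i < n.+1) c i].

Definition nregular (S : pzRingType) (D : connRing S) (z : D) (n : nat) :=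
  forall a : D, z * a = 0 -> gdeg_le n a -> a = 0.

Definition regular (S : pzRingType) (D : connRing S) (z : D) : Prop :=
  forall n, nregular z n.

Definition central (R : pzRingType) (z : R) : Prop :=
  forall x, GRing.comm z x.

Section Grading.
Variables (X : zmodType) (G : nat -> set X) (hG : is_grading G).

Lemma grading0 n : G n 0. Proof. by case: (grading_zmod hG n). Qed.
Lemma gradingB n x y : G n x -> G n y -> G n (x - y).
Proof. by case: (grading_zmod hG n) => _; apply. Qed.
Lemma gradingN n x : G n x -> G n (- x).
Proof. by move=> Gx; rewrite -sub0r; apply: gradingB Gx; exact: grading0. Qed.
Lemma gradingD n x y : G n x -> G n y -> G n (x + y).
Proof. by move=> Gx /gradingN Gy; rewrite -[y]opprK; exact: gradingB. Qed.

Lemma grading_decomp x : exists c : nat -> X, exists N : nat,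
  [/\ forall n, G n (c n), forall n, (N <= n)%N -> c n = 0
    & x = \sum_(n < N) c n].
Proof.
have [c [N [Gc ->]]] := grading_span hG x.
exists (fun n => if (n < N)%N then c n else 0), N; split.
- by move=> n; case: ifP => // _; exact: grading0.
- by move=> n; rewrite leqNgt => /negbTE ->.
- by apply: eq_bigr => i _; rewrite ltn_ord.
Qed.

Definition hcomp (n : nat) (x : X) : X := projT1 (cid (grading_decomp x)) n.

Lemma hcompP x : exists N : nat,
  [/\ forall n, G n (hcomp n x), forall n, (N <= n)%N -> hcomp n x = 0
    & x = \sum_(n < N) hcomp n x].
Proof. exact: projT2 (cid (grading_decomp x)). Qed.

Lemma hcomp_deg x n : G n (hcomp n x).
Proof. by case: (hcompP x) => N []. Qed.

Lemma sum_widen (c : nat -> X) (m n : nat) :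
  (m <= n)%N -> (forall i, (m <= i)%N -> c i = 0) ->
  \sum_(i < m) c i = \sum_(i < n) c i.
Proof.
move=> le_mn c0; rewrite (big_ord_widen n c le_mn) [RHS](bigID (fun i : 'I_n => (i < m)%N)) /=.
by rewrite [X in _ + X]big1 ?addr0 // => i; rewrite -leqNgt => /c0.
Qed.

Lemma hcomp_uniq x (c : nat -> X) (N : nat) :
  (forall n, G n (c n)) -> (forall n, (N <= n)%N -> c n = 0) ->
  x = \sum_(n < N) c n -> hcomp^~ x =1 c.
Proof.
move=> Gc c0 xc n; have [N' [Gh h0 xh]] := hcompP x.
have le1 : (N <= maxn n.+1 (maxn N N'))%N by rewrite !leq_max leqnn orbT.
have le2 : (N' <= maxn n.+1 (maxn N N'))%N by rewrite !leq_max leqnn !orbT.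
have: \sum_(i < maxn n.+1 (maxn N N')) (hcomp i x - c i) = 0.
  by rewrite sumrB -(sum_widen le1 c0) -(sum_widen le2 h0) -xh -xc subrr.
move/(grading_free hG (c := fun i => hcomp i x - c i)) => /(_ _ n).
move=> H; apply/eqP; rewrite -subr_eq0; apply/eqP; apply: H.
  by move=> i; exact: gradingB.
by rewrite leq_max leqnn.
Qed.

Lemma hcompB x y n : hcomp n (x - y) = hcomp n x - hcomp n y.
Proof.
have [N [Gx x0 xE]] := hcompP x; have [N' [Gy y0 yE]] := hcompP y.
rewrite (@hcomp_uniq _ (fun n => hcomp n x - hcomp n y) (maxn N N')) //.
- by move=> i; exact: gradingB.
- by move=> i; rewrite geq_max => /andP[/x0 -> /y0 ->]; rewrite subr0.
by rewrite sumrB -(sum_widen (leq_maxl N N') x0)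
           -(sum_widen (leq_maxr N N') y0) -xE -yE.
Qed.

HB.instance Definition _ n :=
  GRing.isZmodMorphism.Build X X (hcomp n) (fun x y => hcompB x y n).

Lemma hcompD x y n : hcomp n (x + y) = hcomp n x + hcomp n y.
Proof. exact: (raddfD (hcomp n)). Qed.
Lemma hcomp0 n : hcomp n 0 = 0.
Proof. exact: (raddf0 (hcomp n)). Qed.

Lemma hcomp_homog m x n : G m x -> hcomp n x = if n == m then x else 0.
Proof.
move=> Gx; apply: (@hcomp_uniq _ (fun n => if n == m then x else 0) m.+1).
- by move=> i; case: eqP => [->//|_]; exact: grading0.
- by move=> i; case: eqP => // -> ; rewrite ltnn.
- rewrite big_ord_recr /= eqxx big1 ?add0r // => i _.
  by rewrite (ltn_eqF (ltn_ord i)).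
Qed.
End Grading.

Section Augmentation.
Variables (S : pzRingType) (D : connRing S).
Let hD := gdeg_grading D.

Lemma gincl_hcomp0 (x : D) : exists s : S, gincl D s = hcomp hD 0 x.
Proof. by apply/gincl_range; exact: hcomp_deg. Qed.

(* The canonical projection $D \to D^0 = S$ *)
Definition aug (x : D) : S := projT1 (cid (gincl_hcomp0 x)).

Lemma gincl_aug x : gincl D (aug x) = hcomp hD 0 x.
Proof. exact: projT2 (cid (gincl_hcomp0 x)). Qed.

Lemma hcomp0M (x y : D) : hcomp hD 0 (x * y) = hcomp hD 0 x * hcomp hD 0 y.
Proof.
have [N [Gx x0 xE]] := hcompP hD x; have [N' [Gy y0 yE]] := hcompP hD y.
pose u := \sum_(n < N) hcomp hD n.+1 x; pose v := \sum_(n < N') hcomp hD n.+1 y.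
have xS : x = hcomp hD 0 x + u.
  rewrite {1}xE (sum_widen (leqnSn N) x0) big_ord_recl /u.
  by congr (_ + _); apply: eq_bigr.
have yS : y = hcomp hD 0 y + v.
  rewrite {1}yE (sum_widen (leqnSn N') y0) big_ord_recl /v.
  by congr (_ + _); apply: eq_bigr.
have pos m (w : D) (k : nat) : gdeg m.+1 w -> hcomp hD 0 w = 0.
  by move=> Gw; rewrite (hcomp_homog hD _ Gw).
have sum0 (k : nat) (F : nat -> D) : (forall i, exists m, gdeg m.+1 (F i)) ->
    hcomp hD 0 (\sum_(i < k) F i) = 0.
  move=> FG; rewrite (raddf_sum (hcomp hD 0)) big1 // => i _.
  by have [m] := FG i; exact: pos 0%N.
rewrite {1}xS {1}yS mulrDl !mulrDr !hcompD.
rewrite (hcomp_homog hD _ (gdegM (Gx 0%N) (Gy 0%N))) eqxx.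
have -> : hcomp hD 0 (hcomp hD 0 x * v) = 0.
  rewrite /v mulr_sumr (sum0 _ (fun j => hcomp hD 0 x * hcomp hD j.+1 y)) //.
  by move=> j; exists j; rewrite -[j.+1]add0n; exact: gdegM.
have uM w m : gdeg m w -> hcomp hD 0 (u * w) = 0.
  move=> Gw; rewrite /u mulr_suml (sum0 _ (fun i => hcomp hD i.+1 x * w)) //.
  by move=> i; exists (i + m)%N; rewrite -addSn; exact: gdegM.
rewrite (uM _ 0%N) // /v mulr_sumr (raddf_sum (hcomp hD 0)) big1 ?addr0 // => i _.
exact: (uM _ i.+1).
Qed.

Fact aug_zmod_morphism : zmod_morphism aug.
Proof.
by move=> x y; apply: (@gincl_inj _ D); rewrite rmorphB !gincl_aug hcompB.
Qed.

Fact aug_monoid_morphism : monoid_morphism aug.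
Proof.
split=> [|x y]; apply: (@gincl_inj _ D).
  by rewrite gincl_aug (hcomp_homog hD _ (gdeg1 D)) eqxx rmorph1.
by rewrite rmorphM !gincl_aug hcomp0M.
Qed.

HB.instance Definition _ := GRing.isZmodMorphism.Build D S aug aug_zmod_morphism.
HB.instance Definition _ := GRing.isMonoidMorphism.Build D S aug aug_monoid_morphism.

Lemma aug_gincl s : aug (gincl D s) = s.
Proof.
apply: (@gincl_inj _ D); rewrite gincl_aug.
have Gs : gdeg 0 (gincl D s) by apply/gincl_range; exists s.
by rewrite (hcomp_homog hD _ Gs).
Qed.

Lemma aug_pos n x : gdeg n.+1 x -> aug x = 0.
Proof.
by move=> Gx; apply: (@gincl_inj _ D); rewrite gincl_aug (hcomp_homog hD _ Gx) rmorph0.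
Qed.

(* [S] as a left [D]-module *)
Definition augmod : lmodType D := resmod S^o aug.

Definition augl (x : D^o) : augmod := aug x.

Fact augl_linear : linear augl.
Proof. by move=> a x y; rewrite /augl /= rmorphD rmorphM. Qed.

HB.instance Definition _ := GRing.isLinear.Build D D^o augmod _ augl augl_linear.

(* [D] as a left [S]-module *)
Definition cmod : lmodType S := resmod (D : pzRingType)^o (gincl D).

Section Homog.
Variable n : nat.

Definition homog_pred : {pred cmod} := fun x => `[< gdeg n (x : D) >].

Fact homog_pred_closed : submod_closed homog_pred.
Proof.
split; first by apply/asboolP; exact: (grading0 hD).
move=> s x y /asboolP Gx /asboolP Gy; apply/asboolP.
apply: (gradingD hD) => //; rewrite -[n]add0n; apply: gdegM => //.
by apply/gincl_range; exists s.
Qed.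

HB.instance Definition _ :=
  GRing.isSubmodClosed.Build S cmod homog_pred homog_pred_closed.

(* The left [S]-module $D^n$ *)
Record homog : Type := Homog { hval : cmod; _ : hval \in homog_pred }.

HB.instance Definition _ := [isSub for hval].
HB.instance Definition _ := [Choice of homog by <:].
HB.instance Definition _ := [SubChoice_isSubLmodule of homog by <:].

Lemma homogP (x : homog) : gdeg n (hval x : D).
Proof. by case: x => x /= /asboolP. Qed.
End Homog.
End Augmentation.

Section QuotientRing.
Variables (R : pzRingType) (z : R).

Definition zideal : {pred R} := fun x => `[< exists y, x = z * y >].

Fact zideal_closed : zmod_closed zideal.
Proof.
split; first by apply/asboolP; exists 0; rewrite mulr0.
move=> _ _ /asboolP[x ->] /asboolP[y ->]; apply/asboolP.
by exists (x - y); rewrite mulrBr.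
Qed.

HB.instance Definition _ := GRing.isZmodClosed.Build R zideal zideal_closed.

Definition zquot of central z : Type := Quotient.quot zideal.

Variable zc : central z.
Local Notation Q := (zquot zc).

HB.instance Definition _ := GRing.Zmodule.on Q.

Definition zquot_pi (x : R) : Q := \pi_(Quotient.quot zideal) x.
Let rep (x : Q) : R := repr (x : Quotient.quot zideal).

Fact zquot_pi_zmod : zmod_morphism zquot_pi.
Proof. by move=> x y; rewrite /zquot_pi raddfB. Qed.

HB.instance Definition _ := GRing.isZmodMorphism.Build R Q zquot_pi zquot_pi_zmod.

Lemma zquot_pi_eq0 x : zquot_pi x = 0 <-> exists y, x = z * y.
Proof. by split=> [/quot_eq0/asboolP|?]; last apply/quot_eq0/asboolP. Qed.

Let repK x : zquot_pi (rep x) = x.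
Proof. exact: reprK. Qed.

Lemma zquot_pi_surj (x : Q) : exists y, zquot_pi y = x.
Proof. by exists (rep x). Qed.

Let mul (x y : Q) : Q := zquot_pi (rep x * rep y).

Lemma zquot_mul (x y : R) : mul (zquot_pi x) (zquot_pi y) = zquot_pi (x * y).
Proof.
apply/eqP; rewrite -subr_eq0 -raddfB; apply/eqP/zquot_pi_eq0.
set x' := rep _; set y' := rep _.
have [a xE] : exists a, x' - x = z * a.
  by apply/zquot_pi_eq0; rewrite raddfB /= repK subrr.
have [b yE] : exists b, y' - y = z * b.
  by apply/zquot_pi_eq0; rewrite raddfB /= repK subrr.
exists (a * y' + x * b).
rewrite mulrDr !mulrA -xE (zc x) -[x * z * b]mulrA -yE mulrBl mulrBr.
by rewrite addrA subrK.
Qed.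

Fact zquot_mulA : associative mul.
Proof.
move=> x y w; rewrite -[x]repK -[y]repK -[w]repK.
by rewrite !zquot_mul mulrA.
Qed.
Fact zquot_mul1 : left_id (zquot_pi 1) mul.
Proof. by move=> x; rewrite -[x]repK zquot_mul mul1r. Qed.
Fact zquot_mulr1 : right_id (zquot_pi 1) mul.
Proof. by move=> x; rewrite -[x]repK zquot_mul mulr1. Qed.
Fact zquot_mulDl : left_distributive mul +%R.
Proof.
move=> x y w; rewrite -[x]repK -[y]repK -[w]repK -raddfD !zquot_mul.
by rewrite mulrDl raddfD.
Qed.
Fact zquot_mulDr : right_distributive mul +%R.
Proof.
move=> x y w; rewrite -[x]repK -[y]repK -[w]repK -raddfD !zquot_mul.
by rewrite mulrDr raddfD.
Qed.

HB.instance Definition _ := GRing.Zmodule_isPzRing.Build Q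
  zquot_mulA zquot_mul1 zquot_mulr1 zquot_mulDl zquot_mulDr.

Fact zquot_pi_monoid : monoid_morphism zquot_pi.
Proof. by split=> // x y; rewrite -zquot_mul. Qed.

HB.instance Definition _ :=
  GRing.isMonoidMorphism.Build R Q zquot_pi zquot_pi_monoid.
End QuotientRing.

Section GradedQuotient.
Variables (S : pzRingType) (D : connRing S) (z : D).
Hypotheses (z1 : gdeg 1 z) (zc : central z).
Let hD := gdeg_grading D.
Local Notation Q := (zquot zc).
Local Notation pi := (zquot_pi zc).

Definition quot_deg (n : nat) : set Q := [set a | exists x, gdeg n x /\ pi x = a].

(* $z D$ is a homogeneous ideal *)
Lemma zideal_homog (c : nat -> D) (N : nat) (y : D) :
  (forall n, gdeg n (c n)) -> \sum_(n < N) c n = z * y ->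
  forall n, (n < N)%N -> exists y', c n = z * y' /\ (n = 0%N -> y' = 0).
Proof.
move=> Gc cE; have [K [Gy y0 yE]] := hcompP hD y.
pose e n := if n is m.+1 then z * hcomp hD m y else 0.
have Ge n : gdeg n (e n).
  case: n => [|n]; first exact: (grading0 hD).
  by rewrite -[n.+1]add1n; exact: gdegM.
pose c' n := if (n < N)%N then c n else 0.
have Gc' n : gdeg n (c' n) by rewrite /c'; case: ifP => // _; exact: (grading0 hD).
have c'0 n : (N <= n)%N -> c' n = 0 by rewrite /c' leqNgt => /negbTE ->.
have e0 n : (K.+1 <= n)%N -> e n = 0.
  by case: n => // n; rewrite ltnS => /y0 /= ->; rewrite mulr0.
have eE : z * y = \sum_(n < K.+1) e n.
  by rewrite big_ord_recl add0r [in LHS]yE mulr_sumr; apply: eq_bigr.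
have c'E : z * y = \sum_(n < N) c' n.
  by rewrite -cE; apply: eq_bigr => i _; rewrite /c' ltn_ord.
move=> n nN; have := hcomp_uniq hD Ge e0 eE n.
rewrite (hcomp_uniq hD Gc' c'0 c'E) /c' nN => ->.
case: n {nN} => [|n] /=; first by exists 0; rewrite mulr0.
by exists (hcomp hD n y).
Qed.

Fact quot_deg_grading : is_grading quot_deg.
Proof.
split.
- move=> n; split; first by exists 0; split; [exact: (grading0 hD)|rewrite rmorph0].
  move=> _ _ [x [Gx <-]] [y [Gy <-]]; exists (x - y); split.
    exact: (gradingB hD).
  by rewrite rmorphB.
- move=> a; have [x <-] := zquot_pi_surj a.
  have [c [N [Gc ->]]] := grading_span hD x.
  exists (fun n => pi (c n)), N; split; last by rewrite rmorph_sum.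
  by move=> n; exists (c n).
- move=> c N /choice[c' c'P] cE.
  have : pi (\sum_(n < N) c' n) = 0.
    by rewrite rmorph_sum -[RHS]cE; apply: eq_bigr => i _; case: (c'P i).
  move=> /zquot_pi_eq0[y yE] n nN.
  have [|y' [y'E _]] := zideal_homog _ yE nN; first by move=> i; case: (c'P i).
  by case: (c'P n) => _ <-; apply/zquot_pi_eq0; exists y'.
Qed.

Definition quot_incl (s : S) : Q := pi (gincl D s).

Fact quot_incl_zmod : zmod_morphism quot_incl.
Proof. by move=> x y; rewrite /quot_incl !rmorphB. Qed.
Fact quot_incl_monoid : monoid_morphism quot_incl.
Proof. by split=> [|x y]; rewrite /quot_incl ?rmorph1 // !rmorphM. Qed.
HB.instance Definition _ := GRing.isZmodMorphism.Build S Q quot_incl quot_incl_zmod.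
HB.instance Definition _ :=
  GRing.isMonoidMorphism.Build S Q quot_incl quot_incl_monoid.

Fact quot_deg1 : quot_deg 0 1.
Proof. by exists 1; split; [exact: gdeg1|rewrite rmorph1]. Qed.

Fact quot_degM m n a b : quot_deg m a -> quot_deg n b -> quot_deg (m + n) (a * b).
Proof.
move=> [x [Gx <-]] [y [Gy <-]]; exists (x * y); split; first exact: gdegM.
by rewrite rmorphM.
Qed.

Fact quot_incl_inj : injective quot_incl.
Proof.
move=> s t /eqP; rewrite -subr_eq0 -rmorphB => /eqP/zquot_pi_eq0[y yE].
apply: (@gincl_inj _ D); apply/eqP; rewrite -subr_eq0 -rmorphB; apply/eqP.
have Gs n : gdeg n (if n is 0%N then gincl D (s - t) else 0).
  case: n => [|n]; last exact: (grading0 hD).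
  by apply/gincl_range; exists (s - t).
have := @zideal_homog _ 1%N y Gs; rewrite big_ord1 => /(_ yE 0%N erefl).
by move=> [y' [/= -> /(_ erefl) ->]]; rewrite mulr0.
Qed.

Fact quot_incl_range a : quot_deg 0 a <-> exists s, quot_incl s = a.
Proof.
split=> [[_ [/gincl_range[s <-] <-]]|[s <-]]; first by exists s.
by exists (gincl D s); split=> //; apply/gincl_range; exists s.
Qed.

(* $A = D / zD$ *)
Definition quot_ring : connRing S :=
  @ConnRing S Q quot_incl quot_deg quot_deg_grading quot_deg1 quot_degM
    quot_incl_inj quot_incl_range.

Definition quot_pi : {rmorphism D -> quot_ring} := pi.

Lemma quot_pi_incl s : quot_pi (gincl D s) = gincl quot_ring s.
Proof. by []. Qed.
End GradedQuotient.

Section Tensor.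
Variables (S B : pzRingType) (iota : {rmorphism S -> B}) (V : lmodType S).

Local Notation F := {freeg (B * V) / int}.

Variant tensor_relator : set F :=
| tensor_relDl x y v :
    tensor_relator (<< (x + y, v) >> - << (x, v) >> - << (y, v) >>)
| tensor_relDr x v w :
    tensor_relator (<< (x, v + w) >> - << (x, v) >> - << (x, w) >>)
| tensor_relZ x s v :
    tensor_relator (<< (x * iota s, v) >> - << (x, s *: v) >>).

Definition tensor : Type :=
  Quotient.quot (zspan_pred tensor_relator).
Local Notation T := tensor.

HB.instance Definition _ := GRing.Zmodule.on T.

Let pi (g : F) : T := \pi_(Quotient.quot (zspan_pred tensor_relator)) g.
Let piB x y : pi (x - y) = pi x - pi y.
Proof. by rewrite /pi raddfB. Qed.
Let pi0 g : zspan tensor_relator g -> pi g = 0.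
Proof. by move=> /zspan_predP/quot_eq0. Qed.

Definition tens (x : B) (v : V) : T := pi << (x, v) >>.

Lemma tensDl x y v : tens (x + y) v = tens x v + tens y v.
Proof.
apply/eqP; rewrite -subr_eq0 opprD addrA /tens -!piB; apply/eqP/pi0/zspan_gen.
exact: tensor_relDl.
Qed.

Lemma tensDr x v w : tens x (v + w) = tens x v + tens x w.
Proof.
apply/eqP; rewrite -subr_eq0 opprD addrA /tens -!piB; apply/eqP/pi0/zspan_gen.
exact: tensor_relDr.
Qed.

Lemma tensZ x s v : tens (x * iota s) v = tens x (s *: v).
Proof.
apply/eqP; rewrite -subr_eq0 /tens -!piB; apply/eqP/pi0/zspan_gen.
exact: tensor_relZ.
Qed.

Lemma tensor_ind (P : T -> Prop) :
  P 0 -> (forall x y, P x -> P y -> P (x - y)) ->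
  (forall x v, P (tens x v)) -> forall t, P t.
Proof.
move=> P0 PB Pt t; rewrite -[t]reprK.
have PN x : P x -> P (- x) by rewrite -sub0r; exact: PB.
have PD x y : P x -> P y -> P (x + y).
  by move=> Px /PN Py; rewrite -[y]opprK; exact: PB.
have piD g h : pi (g + h) = pi g + pi h by rewrite /pi raddfD.
have piMz k g : pi (g *~ k) = pi g *~ k by rewrite /pi raddfMz.
have PM x (k : int) : P x -> P (x *~ k).
  move=> Px; have PMn (n : nat) : P (x *+ n).
    by elim: n => [|n IHn]; rewrite ?mulr0n // mulrS; exact: PD.
  by case: k => n; [exact: PMn | rewrite NegzE mulrNz; exact/PN/PMn].
rewrite -/(pi (repr t)) -[repr t]freeg_sumE.
elim: (dom _) => [|[x v] s IHs]; first by rewrite big_nil /pi raddf0.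
rewrite big_cons piD; apply: PD => //.
by rewrite -[coeff _ _]intz -freegU_mulz piMz; apply: PM; exact: Pt.
Qed.

Definition balanced (U : zmodType) (f : B -> V -> U) : Prop :=
  [/\ forall x y v, f (x + y) v = f x v + f y v,
      forall x v w, f x (v + w) = f x v + f x w
    & forall x s v, f (x * iota s) v = f x (s *: v)].

Section Lift.
Variables (U : zmodType) (f : B -> V -> U).

Definition tensor_lift of balanced f : T -> U := fun t =>
  fglift (fun p => f p.1 p.2 : zmodule U)
    (repr (t : Quotient.quot (zspan_pred tensor_relator))).

Variable bf : balanced f.

Let g (x : F) : U := fglift (fun p => f p.1 p.2 : zmodule U) x.
Let gB x y : g (x - y) = g x - g y.
Proof. exact: (lift_is_additive (fun p => f p.1 p.2 : zmodule U) x y). Qed.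
Let g1 x v : g << (x, v) >> = f x v.
Proof. by rewrite /g liftU scale1r. Qed.

Let g_rel x : zspan tensor_relator x -> g x = 0.
Proof.
case: bf => fDl fDr fZ; elim=> [_ []|| a b _ ga _ gb].
- by move=> a b v; rewrite !gB !g1 fDl addrAC addrK subrr.
- by move=> a b v; rewrite !gB !g1 fDr addrAC addrK subrr.
- by move=> a b v; rewrite !gB !g1 fZ subrr.
- by rewrite -(subrr 0) gB subrr.
- by rewrite gB ga gb subrr.
Qed.

Let lift_pi x : tensor_lift bf (pi x) = g x.
Proof.
apply/eqP; rewrite -subr_eq0 -gB; apply/eqP/g_rel/zspan_predP/quot_eq0.
by rewrite raddfB /= reprK subrr.
Qed.

Lemma tensor_liftE x v : tensor_lift bf (tens x v) = f x v.
Proof. by rewrite lift_pi g1. Qed.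

Fact tensor_lift_zmod : zmod_morphism (tensor_lift bf).
Proof.
by move=> x y; rewrite -[x]reprK -[y]reprK -/(pi _) -/(pi (repr y)) -piB !lift_pi gB.
Qed.

HB.instance Definition _ :=
  GRing.isZmodMorphism.Build T U (tensor_lift bf) tensor_lift_zmod.
End Lift.

Lemma tensor_ext (U : zmodType) (f g : {additive T -> U}) :
  (forall x v, f (tens x v) = g (tens x v)) -> f =1 g.
Proof.
move=> fg; apply: tensor_ind => [|x y fgx fgy|//]; first by rewrite !raddf0.
by rewrite !raddfB fgx fgy.
Qed.

Fact tensor_scale_balanced (b : B) : balanced (fun x v => tens (b * x) v).
Proof.
split=> [x y v|x v w|x s v]; first by rewrite mulrDr tensDl.
  exact: tensDr.
by rewrite mulrA tensZ.
Qed.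

Let scale (b : B) : T -> T := tensor_lift (tensor_scale_balanced b).
Let scaleE b x v : scale b (tens x v) = tens (b * x) v.
Proof. exact: tensor_liftE. Qed.
Let scaleB b : {morph scale b : x y / x - y}.
Proof. by move=> x y; rewrite /scale raddfB. Qed.

Fact tensor_scaleA a b t : scale a (scale b t) = scale (a * b) t.
Proof.
elim/tensor_ind: t => [|x y IHx IHy|x v]; first by rewrite /scale !raddf0.
  by rewrite !scaleB IHx IHy.
by rewrite !scaleE mulrA.
Qed.
Fact tensor_scale1 : left_id 1 scale.
Proof.
elim/tensor_ind => [|x y IHx IHy|x v]; first by rewrite /scale !raddf0.
  by rewrite !scaleB IHx IHy.
by rewrite !scaleE mul1r.
Qed.
Fact tensor_scaleDr : right_distributive scale +%R.
Proof. by move=> b x y; rewrite /scale raddfD. Qed.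
Fact tensor_scaleDl t : {morph scale^~ t : a b / a + b}.
Proof.
move=> a b; elim/tensor_ind: t => [|x y IHx IHy|x v].
- by rewrite /scale !raddf0 addr0.
- by rewrite !scaleB IHx IHy opprD addrACA.
- by rewrite !scaleE mulrDl tensDl.
Qed.

HB.instance Definition _ := GRing.Zmodule_isLmodule.Build B T
  tensor_scaleA tensor_scale1 tensor_scaleDr tensor_scaleDl.

Lemma tensor_scaleE b x v : b *: tens x v = tens (b * x) v.
Proof. exact: scaleE. Qed.
End Tensor.

Arguments tensor {S B} iota V.
Arguments tens {S B iota V} x v.

(* [p ⊗ V : B ⊗ V -> B' ⊗ V] for a morphism [p] of [S]-rings *)
Section TensorMap.
Variables (S B B' : pzRingType).
Variables (iota : {rmorphism S -> B}) (iota' : {rmorphism S -> B'}).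
Variables (p : {rmorphism B -> B'}) (p_iota : forall s, p (iota s) = iota' s).
Variable V : lmodType S.

Fact tensor_map_balanced :
  balanced iota (fun x v => tens (p x) v : tensor iota' V).
Proof.
split=> [x y v|x v w|x s v]; first by rewrite rmorphD tensDl.
  exact: tensDr.
by rewrite rmorphM p_iota tensZ.
Qed.

Definition tensor_map : tensor iota V -> tensor iota' V :=
  tensor_lift tensor_map_balanced.

HB.instance Definition _ :=
  GRing.Additive.copy tensor_map (tensor_lift tensor_map_balanced).

Lemma tensor_mapE x v : tensor_map (tens x v) = tens (p x) v.
Proof. exact: tensor_liftE. Qed.
End TensorMap.

Section Concentrated.
Variables (S : pzRingType) (X : lmodType S) (k : nat).

Definition conc_deg (n : nat) : set X := if n == k then setT else [set 0]%classic.

Fact conc_grading : is_grading conc_deg.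
Proof.
rewrite /conc_deg; split.
- by move=> n; case: eqP => _; split=> // x y -> ->; rewrite subr0.
- move=> x; exists (fun n => if n == k then x else 0), k.+1; split.
    by move=> n; case: eqP.
  rewrite big_ord_recr /= eqxx big1 ?add0r // => i _.
  by rewrite (ltn_eqF (ltn_ord i)).
- move=> c N Gc cE n nN; have := Gc n; case: eqP => // nk _.
  rewrite -cE (bigD1 (Ordinal nN)) //= big1 ?addr0 // => i.
  rewrite -val_eqE /= nk => /negbTE ik.
  by have := Gc i; rewrite ik.
Qed.

Fact conc_scale n (s : S) x : conc_deg n x -> conc_deg n (s *: x).
Proof. by rewrite /conc_deg; case: eqP => // _ ->; rewrite /= scaler0. Qed.

(* [X] placed in degree [k] *)
Definition concentrated : gradedMod S := GradedMod conc_grading conc_scale.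
End Concentrated.

Section Extension.
Variables (S : pzRingType) (B : connRing S) (V : nat -> gradedMod S).

Definition tensor_deg (W : gradedMod S) (n : nat) : set (tensor (gincl B) W) :=
  zspan [set t | exists i j x v,
    [/\ gdeg i x, gmdeg j v, (i + j)%N = n & t = tens x v]].

(* [B ⊗ V_n], where [V_0 = S] and [B ⊗ S] is identified with [B] *)
Definition ext (n : nat) : lmodType B :=
  if n is m.+1 then tensor (gincl B) (V m.+1) else (B : pzRingType)^o.

Definition ext_deg (n : nat) : nat -> set (ext n) :=
  match n return nat -> set (ext n) with
  | 0 => @gdeg S B
  | m.+1 => @tensor_deg (V m.+1)
  end.
End Extension.

(* $V_0 = S$, $V_1 = A^1$ and $V_{m+2}$ = [W m] *)
Definition gens (S : pzRingType) (A : connRing S) (W : nat -> gradedMod S)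
    (n : nat) : gradedMod S :=
  match n with
  | 0 => concentrated (S : pzRingType)^o 0
  | 1 => concentrated (homog A 1) 1
  | m.+2 => W m
  end.

(* [res_d n] is $d_{n+1} : A \otimes V_{n+1} \to A \otimes V_n$ *)
Record resolution_data (S : pzRingType) (A : connRing S) := ResolutionData {
  res_W : nat -> gradedMod S;
  res_V := gens A res_W;
  res_W_proj : forall m, projective (res_W m);
  res_W_low : forall m i, (i < 2)%N -> gmdeg (g := res_W m) i = [set 0]%classic;
  res_d : forall n, {linear ext A res_V n.+1 -> ext A res_V n};
  res_d_graded : forall n,
    graded_map (ext_deg (V := res_V) (n := n.+1)) (ext_deg (n := n)) (res_d n);
  res_d1 : forall (a : A) (b : homog A 1),
    res_d 0 (tens a b : tensor (gincl A) (homog A 1)) = a * (hval b : A);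
  res_exact : resolution res_d (@augl S A)
}.

Section Construction.
Variables (S : pzRingType) (D : connRing S) (z : D).
Hypotheses (z1 : gdeg 1 z) (zc : central z).
Local Notation A := (quot_ring z1 zc).
Local Notation pi := (quot_pi z1 zc).

(* $\pi \otimes V_n$ *)
Definition ext_pi (V : nat -> gradedMod S) (n : nat) : ext D V n -> ext A V n :=
  match n return ext D V n -> ext A V n with
  | 0 => pi
  | m.+1 => tensor_map (quot_pi_incl z1 zc) (V := V m.+1)
  end.

Variable P : resolution_data A.
Local Notation V := (res_V P).

(* $N_n = D \otimes V_n$ *)
Definition Nmod (n : nat) : lmodType D := ext D V n.
Definition Ndeg (n : nat) : nat -> set (Nmod n) := @ext_deg S D V n.

(* [lift_d n] is $\partial_{n+1} : N_{n+1} \to N_n$ and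
   [lift_f n] is $f_{n+2} : N_{n+2} \to N_n(-1)$ *)
Record lifting_data := LiftingData {
  lift_sigma : {linear homog A 1 -> homog D 1};
  lift_d : forall n, {linear Nmod n.+1 -> Nmod n};
  lift_f : forall n, {linear Nmod n.+2 -> Nmod n};
  lift_sigma_section : forall a, pi (hval (lift_sigma a)) = hval a;
  lift_d_graded : forall n, graded_map (@Ndeg n.+1) (@Ndeg n) (lift_d n);
  lift_d_pi : forall n x, ext_pi (lift_d n x) = res_d P n (ext_pi x);
  lift_d1 : forall (x : D) (a : homog A 1),
    lift_d 0 (tens x a : tensor (gincl D) (homog A 1)) =
    x * (hval (lift_sigma a) : D);
  lift_f_graded : forall n,
    graded_map (@Ndeg n.+2) (shiftN1 (@Ndeg n)) (lift_f n);
  lift_dd : forall n x,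
    lift_d n (lift_d n.+1 x) = ((-1) ^+ n.+1 * z) *: lift_f n x
}.

Variable L : lifting_data.

(* $M_n = N_n \oplus N_{n-1}(-1)$ with $N_{-1} = 0$ *)
Definition Mmod (n : nat) : lmodType D :=
  if n is m.+1 then (Nmod m.+1 * Nmod m)%type else Nmod 0.

Definition Mdeg (n : nat) : nat -> set (Mmod n) :=
  match n return nat -> set (Mmod n) with
  | 0 => @Ndeg 0
  | m.+1 => fun k => [set p | Ndeg k p.1 /\ shiftN1 (@Ndeg m) k p.2]%classic
  end.

(* [delta n] is $\delta_{n+1} : M_{n+1} \to M_n$ *)
Definition delta_fun (n : nat) : Mmod n.+1 -> Mmod n :=
  match n return Mmod n.+1 -> Mmod n with
  | 0 => fun p => lift_d L 0 p.1 + z *: p.2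
  | m.+1 => fun p =>
      (lift_d L m.+1 p.1 + ((-1) ^+ m.+1 * z) *: p.2,
       lift_d L m p.2 + lift_f L m p.1)
  end.

Fact delta_linear n : linear (@delta_fun n).
Proof.
have zZ (X : lmodType D) (c b : D) (x : X) : central c ->
    c *: (b *: x) = b *: (c *: x).
  by move=> cc; rewrite !scalerA cc.
have sc k : central ((-1) ^+ k * z).
  move=> x; rewrite /GRing.comm -[_ * z * x]mulrA (zc x) !mulrA; congr (_ * _).
  by elim: k => [|k IHk]; rewrite ?mul1r ?mulr1 // exprS !mulN1r mulrN mulNr IHk.
case: n => [|n] b [x y] [x' y'] /=.
  rewrite (linearP (lift_d L 0)) [z *: (_ + _)]scalerDr zZ //.
  by rewrite [b *: (_ + _)]scalerDr addrACA.
congr (_, _); rewrite /=.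
  rewrite (linearP (lift_d L n.+1)) [(_ * z) *: (_ + _)]scalerDr zZ //.
  by rewrite [b *: (_ + _)]scalerDr addrACA.
rewrite (linearP (lift_d L n)) (linearP (lift_f L n)).
by rewrite [b *: (_ + _)]scalerDr addrACA.
Qed.

HB.instance Definition _ n :=
  GRing.isLinear.Build D (Mmod n.+1) (Mmod n) _ (@delta_fun n) (@delta_linear n).

Definition delta (n : nat) : {linear Mmod n.+1 -> Mmod n} := @delta_fun n.

Lemma Ndeg_scale (n i k : nat) (c : D) (x : Nmod n) :
  gdeg i c -> Ndeg k x -> Ndeg (i + k) (c *: x).
Proof.
case: n x => [|n] x Gc; first exact: gdegM.
elim=> {x} [_ [a [b [u [v [Gu Gv <- ->]]]]]||x y _ IHx _ IHy].
- rewrite tensor_scaleE; apply: zspan_gen; exists (i + a)%N, b, (c * u), v.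
  by split=> //; [exact: gdegM | rewrite addnA].
- by rewrite scaler0; exact: zspan0.
- by rewrite scalerBr; exact: zspanB.
Qed.

Lemma Ndeg_subgroup n k : set_subgroup (@Ndeg n k).
Proof.
case: n => [|n]; first exact: (grading_zmod (gdeg_grading D)).
by split; [exact: zspan0 | exact: zspanB].
Qed.

Lemma delta_graded n : graded_map (@Mdeg n.+1) (@Mdeg n) (delta n).
Proof.
have ND m k (x y : Nmod m) : Ndeg k x -> Ndeg k y -> Ndeg k (x + y).
  have [N0 NB] := Ndeg_subgroup m k => Nx Ny.
  by rewrite -[y]opprK; apply: (NB) => //; rewrite -sub0r; apply: (NB).
have zN m k (c : D) (x : Nmod m) :
    gdeg 1 c -> shiftN1 (@Ndeg m) k x -> Ndeg k (c *: x).
  case: k => [|k] Gc; last by rewrite -[k.+1]add1n; exact: Ndeg_scale.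
  by move=> ->; rewrite scaler0; case: (Ndeg_subgroup m 0).
have sN m k (x y : Nmod m) : shiftN1 (@Ndeg m) k x -> shiftN1 (@Ndeg m) k y ->
    shiftN1 (@Ndeg m) k (x + y).
  by case: k => [-> ->|k]; [rewrite /= addr0 | exact: ND].
have z1s k : gdeg 1 ((-1) ^+ k * z).
  elim: k => [|k IHk]; first by rewrite mul1r.
  by rewrite exprS mulN1r mulNr; exact: (gradingN (gdeg_grading D)).
case: n => [|n] k [x y] /= [Nx Ny].
  by apply: (ND 0%N k); [exact: (@lift_d_graded L 0%N) | exact: (zN 0%N k)].
split=> /=; first by apply: (ND n.+1 k); [exact: (@lift_d_graded L n.+1) | exact: (zN n.+1 k)].
apply: (sN n k); last exact: (@lift_f_graded L n).
case: k Ny {Nx} => [->|k Ny]; last exact: (@lift_d_graded L n k).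
exact: (linear0 (lift_d L n)).
Qed.

(* $\delta_0 : M_0 = D \to S$ *)
Definition delta0 : {linear Mmod 0 -> augmod D} := @augl S D.
End Construction.

(* Main.v *)
(* If [z] is regular, so is its action on each [N_n], since [V_n] is projective;
   hence the obstruction [∂ f + f ∂] to [δ δ = 0], which [z] kills, vanishes.
   A cycle [(x, y)] is then a boundary: modulo [z] the resolution over [A] gives
   [x = ∂ w + z u], which reduces [x] to [0], and [(0, y)] is a cycle only if
   [z y = 0].
   Conversely, let [z a = 0]. Then [(0, a)] is a cycle in [M_1], hence a boundary
   [δ (x, y)], and the same reduction, possible as [M_3 -> M_2 -> M_1] is a
   complex, makes [x = 0]. This leaves [y] in [D ⊗ A^1] with [z y = 0] and
   [∂ y = a]. As [∂] raises the degree of the [D]-component by one and [A^1] is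
   projective, the vanishing of the components of degree [m] of annihilators of
   [z] implies that of their components of degree [m + 1]. *)

Require Import Defs.
From HB Require Import structures.
From mathcomp Require Import all_boot all_order all_algebra.
From mathcomp Require Import ring_quotient generic_quotient.
From mathcomp Require Import boolp classical_sets functions.

Set Implicit Arguments.
Unset Strict Implicit.
Unset Printing Implicit Defensive.

Import GRing.Theory.
Local Open Scope ring_scope.

(** * Coordinate functionals of a projective module *)

Section DualBasis.
Variables (S : pzRingType) (P : lmodType S).

(* The pairs [(f, v)] for which [v = sum_e f e *: e] is a sum with finitely many
   nonzero terms; [f] itself may have infinite support. *)
Definition eval_graph : {pred ((P -> S^o) * P)%type} := fun p =>
  `[< exists s : seq P, forall s', uniq s' -> {subset s <= s'} ->
      p.2 = \sum_(e <- s') (p.1 e : S) *: (e : P) >].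

Fact eval_graph_closed : submod_closed eval_graph.
Proof.
split; first by apply/asboolP; exists [::] => s' _ _; rewrite big1 // => e _; rewrite scale0r.
move=> a x y /asboolP[s1 Hx] /asboolP[s2 Hy]; apply/asboolP; exists (s1 ++ s2).
move=> s' us' ss'; rewrite /= (Hx s') // ?(Hy s') //; last 2 first.
- by move=> e e_s; apply: ss'; rewrite mem_cat e_s orbT.
- by move=> e e_s; apply: ss'; rewrite mem_cat e_s.
rewrite scaler_sumr -big_split; apply: eq_bigr => e _ /=.
by rewrite scalerDl scalerA.
Qed.

HB.instance Definition _ :=
  GRing.isSubmodClosed.Build S _ eval_graph eval_graph_closed.

(** A substitute for the free module on the set [P]: it maps onto [P] and has linear
    coefficients. *)
Record eval_module : Type :=
  EvalModule { em_val : ((P -> S^o) * P)%type; _ : em_val \in eval_graph }.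

HB.instance Definition _ := [isSub for em_val].
HB.instance Definition _ := [Choice of eval_module by <:].
HB.instance Definition _ := [SubChoice_isSubLmodule of eval_module by <:].

Definition eval_sum (p : eval_module) : P := (em_val p).2.
Fact eval_sum_linear : linear eval_sum. Proof. by []. Qed.
HB.instance Definition _ :=
  GRing.isLinear.Build S eval_module P _ eval_sum eval_sum_linear.

Definition eval_coef (e : P) (p : eval_module) : S^o := (em_val p).1 e.
Fact eval_coef_linear e : linear (eval_coef e). Proof. by []. Qed.
HB.instance Definition _ e :=
  GRing.isLinear.Build S eval_module S^o _ (eval_coef e) (eval_coef_linear e).

Lemma eval_sum_surj v : exists p, eval_sum p = v.
Proof.
have vG : (fun e => (e == v)%:R : S^o, v) \in eval_graph.
  apply/asboolP; exists [:: v] => s us vs.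
  rewrite (bigD1_seq v) ?vs ?mem_head //= eqxx scale1r big1 ?addr0 // => e.
  by move=> /negbTE ->; rewrite scale0r.
by exists (EvalModule vG).
Qed.

(** The functionals are the coefficients of a section of [eval_sum]. The expansion holds over every
    longer list, so that several vectors can share one. *)
Lemma projective_dual_basis : projective P ->
  exists phi : P -> {linear P -> S^o}, forall v, exists s : seq P,
    forall s', uniq s' -> {subset s <= s'} -> v = \sum_(e <- s') (phi e v : S) *: (e : P).
Proof.
move=> /(_ eval_module P eval_sum idfun eval_sum_surj)[k kE].
exists (fun e => eval_coef e \o k) => v.
have : em_val (k v) \in eval_graph by case: (k v).
by move=> /asboolP[s Hs]; exists s => s' us' ss'; rewrite -[LHS]kE; exact: Hs.
Qed.
End DualBasis.

(** * Torsion in [B ⊗ V] for projective [V] *)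

Section TensorEnd.
Variables (S B : pzRingType) (iota : {rmorphism S -> B}).

Section Map.
Variables (V : lmodType S) (q : {additive B -> B}).
Hypothesis qZ : forall x s, q (x * iota s) = q x * iota s.

Fact tensor_end_balanced : balanced iota (fun x v => tens (q x) v : tensor iota V).
Proof.
split=> [x y v|x v w|x s v]; first by rewrite raddfD tensDl.
  exact: tensDr.
by rewrite qZ tensZ.
Qed.

(** This is [q ⊗ V]. Asking right [S]-linearity of [q] admits projections onto homogeneous
    components. *)
Definition tensor_end : tensor iota V -> tensor iota V :=
  tensor_lift tensor_end_balanced.

HB.instance Definition _ :=
  GRing.Additive.copy tensor_end (tensor_lift tensor_end_balanced).

Lemma tensor_endE x v : tensor_end (tens x v) = tens (q x) v.
Proof. exact: tensor_liftE. Qed.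
End Map.

Section Contraction.
Variables (V : lmodType S) (phi : {linear V -> S^o}).

Fact contract_balanced : balanced iota (fun x v => x * iota (phi v) : B).
Proof.
split=> [x y v|x v w|x s v]; first exact: mulrDl.
  by rewrite raddfD rmorphD mulrDr.
by rewrite linearZ rmorphM mulrA.
Qed.

(** The extension [B ⊗ V -> B ⊗ S = B] of [phi]. *)
Definition contract : tensor iota V -> B := tensor_lift contract_balanced.

HB.instance Definition _ :=
  GRing.Additive.copy contract (tensor_lift contract_balanced).

Lemma contractE x v : contract (tens x v) = x * iota (phi v).
Proof. exact: tensor_liftE. Qed.

Lemma contractZ b t : contract (b *: t) = b * contract t.
Proof.
elim/tensor_ind: t => [|x y IHx IHy|x v]; first by rewrite scaler0 !raddf0 mulr0.
  by rewrite scalerBr !raddfB /= IHx IHy mulrBr.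
by rewrite tensor_scaleE !contractE mulrA.
Qed.
End Contraction.

Lemma tens0l (V : lmodType S) (v : V) : tens 0 v = 0 :> tensor iota V.
Proof. by apply: (addrI (tens 0 v)); rewrite -tensDl !addr0. Qed.

Lemma tensBl (V : lmodType S) x y (v : V) :
  tens (x - y) v = tens x v - tens y v :> tensor iota V.
Proof. by apply: (addIr (tens y v)); rewrite -tensDl !subrK. Qed.

Lemma tens_sumr (V : lmodType S) (I : Type) (s : seq I) x (F : I -> V) :
  tens x (\sum_(i <- s) F i) = \sum_(i <- s) tens x (F i) :> tensor iota V.
Proof.
elim: s => [|i s IHs]; last by rewrite !big_cons tensDr IHs.
by rewrite !big_nil; apply: (addrI (tens x 0)); rewrite -tensDr !addr0.
Qed.

(* A projective [V] has enough coordinate functionals to detect [(q ⊗ V) t = 0]. *)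
Lemma tensor_end_eq0 (V : lmodType S) (q : {additive B -> B})
    (qZ : forall x s, q (x * iota s) = q x * iota s) (z : B) (t : tensor iota V) :
  projective V -> (forall a, z * a = 0 -> q a = 0) ->
  z *: t = 0 -> tensor_end qZ t = 0.
Proof.
move=> /projective_dual_basis[phi phiP] zq zt.
(* The expansion in [V] carries over to [B ⊗ V], with contractions as coordinates. *)
have [s /(_ (undup s))] : exists s : seq V, forall s', uniq s' -> {subset s <= s'} ->
    t = \sum_(e <- s') tens (contract (phi e) t) e.
  elim/tensor_ind: t {zt} => [|x y [sx Hx] [sy Hy]|x v].
  - by exists [::] => s' _ _; rewrite big1 // => e _; rewrite raddf0 tens0l.
  - exists (sx ++ sy) => s' us' ss'.
    have ssx : {subset sx <= s'} by move=> e e_s; apply: ss'; rewrite mem_cat e_s.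
    have ssy : {subset sy <= s'} by move=> e e_s; apply: ss'; rewrite mem_cat e_s orbT.
    under eq_bigr => e _ do rewrite raddfB /= tensBl.
    by rewrite sumrB -(Hx s' us' ssx) -(Hy s' us' ssy).
  - have [s Hs] := phiP v; exists s => s' us' ss'.
    rewrite {1}(Hs s' us' ss') tens_sumr; apply: eq_bigr => e _.
    by rewrite contractE tensZ.
rewrite undup_uniq => /(_ isT) ->; last by move=> e; rewrite mem_undup.
(* Contraction is [B]-linear, so [z] kills each coordinate of [t], and hence so does [q]. *)
rewrite raddf_sum big1 // => e _; rewrite /= tensor_endE zq ?tens0l //.
by rewrite -contractZ zt raddf0.
Qed.

Lemma tensor_regular (V : lmodType S) (z : B) (t : tensor iota V) :
  projective V -> (forall a, z * a = 0 -> a = 0) -> z *: t = 0 -> t = 0.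
Proof.
move=> V_proj z_reg zt.
have id_tens : tensor_end (V := V) (q := idfun) (fun _ _ => erefl) =1 idfun.
  by apply: tensor_ext => x v; rewrite /= tensor_endE.
by rewrite -[t]id_tens; apply: tensor_end_eq0 zt.
Qed.
End TensorEnd.

(** * Surjectivity and kernel of [π ⊗ V] *)

Section ReductionModZ.
Variables (S : pzRingType) (D : connRing S) (z : D).
Hypotheses (z1 : gdeg 1 z) (zc : central z).
Variable V : lmodType S.
Local Notation A := (quot_ring z1 zc).
Local Notation pi := (quot_pi z1 zc).
Local Notation N := (tensor (gincl D) V).
Local Notation piV := (tensor_map (quot_pi_incl z1 zc) (V := V)).

Lemma tensor_map_surj (t : tensor (gincl A) V) : exists u, piV u = t.
Proof.
elim/tensor_ind: t => [|_ _ [x <-] [y <-]|a v].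
- by exists 0; rewrite raddf0.
- by exists (x - y); rewrite raddfB.
- have [x <-] := @zquot_pi_surj D z zc a.
  by exists (tens x v); rewrite tensor_mapE.
Qed.

Lemma tensor_map_z u : piV (z *: u) = 0.
Proof.
elim/tensor_ind: u => [|x y IHx IHy|x v]; first by rewrite scaler0 raddf0.
  by rewrite scalerBr raddfB /= IHx IHy subrr.
rewrite tensor_scaleE tensor_mapE (_ : pi (z * x) = 0) ?tens0l //.
by apply/zquot_pi_eq0; exists x.
Qed.

Definition zmult : {pred N} := fun t => `[< exists u, t = z *: u >].

Fact zmult_closed : zmod_closed zmult.
Proof.
split; first by apply/asboolP; exists 0; rewrite scaler0.
move=> _ _ /asboolP[x ->] /asboolP[y ->]; apply/asboolP.
by exists (x - y); rewrite scalerBr.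
Qed.

HB.instance Definition _ := GRing.isZmodClosed.Build N zmult zmult_closed.

Let cls (t : N) : Quotient.quot zmult := (\pi_(Quotient.quot zmult) t)%qT.
Let clsB x y : cls (x - y) = cls x - cls y.
Proof. by rewrite /cls raddfB. Qed.
Let clsD x y : cls (x + y) = cls x + cls y.
Proof. by rewrite /cls raddfD. Qed.
Let cls_eq0 t : cls t = 0 <-> exists u, t = z *: u.
Proof. by split=> [/quot_eq0/asboolP|?]; last apply/quot_eq0/asboolP. Qed.

Let rep (a : A) : D := projT1 (cid (@zquot_pi_surj D z zc a)).
Let repK a : pi (rep a) = a.
Proof. exact: projT2 (cid (@zquot_pi_surj D z zc a)). Qed.

(** The choice [rep] need not be additive or multiplicative; its deviation is a multiple of [z] and
    vanishes modulo [z N]. *)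
Let cls_rep x v : cls (tens (rep (pi x)) v) = cls (tens x v).
Proof.
apply/eqP; rewrite -subr_eq0 -clsB -tensBl; apply/eqP/cls_eq0.
have /zquot_pi_eq0[y ->] : pi (rep (pi x) - x) = 0 by rewrite rmorphB repK subrr.
by exists (tens y v); rewrite tensor_scaleE.
Qed.

(* The inverse of the map [N / z N -> A ⊗ V] induced by [π ⊗ V]. *)
Fact unreduce_balanced :
  balanced (gincl A) (fun a v => cls (tens (rep a) v)).
Proof.
split=> [a b v|a v w|a s v].
- by rewrite -{1}[a]repK -{1}[b]repK -rmorphD cls_rep tensDl clsD.
- by rewrite tensDr clsD.
- by rewrite -{1}[a]repK -[gincl A s]quot_pi_incl -rmorphM cls_rep tensZ.
Qed.

(** The map lifted from [unreduce_balanced] recovers the class of [u] modulo [z N] from [piV u]. *)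
Lemma tensor_map_eq0 t : piV t = 0 -> exists u, t = z *: u.
Proof.
pose g : {additive tensor (gincl A) V -> _} := tensor_lift unreduce_balanced.
have gK u : g (piV u) = cls u.
  elim/tensor_ind: u => [|x y IHx IHy|x v].
  - rewrite [cls 0]raddf0 [piV 0]raddf0. exact: raddf0.
  - by rewrite !raddfB /= IHx IHy clsB.
  - by rewrite tensor_mapE [LHS]tensor_liftE cls_rep.
by move=> t0; apply: (cls_eq0 t).1; rewrite -gK t0 raddf0.
Qed.
End ReductionModZ.

(** * Extension of scalars and its adjunction with restriction *)

Section ExtensionOfScalars.
Variables (S B : pzRingType) (iota : {rmorphism S -> B}).

Section Extend.
Variables (V : lmodType S) (X : lmodType B) (k : {linear V -> resmod X iota}).

Fact extend_balanced : balanced iota (fun x v => x *: (k v : X)).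
Proof.
split=> [x y v|x v w|x s v]; first exact: scalerDl.
  by rewrite linearD scalerDr.
by rewrite linearZ -scalerA.
Qed.

Definition extend : tensor iota V -> X := tensor_lift extend_balanced.

Lemma extendE x v : extend (tens x v) = x *: (k v : X).
Proof. exact: tensor_liftE. Qed.

HB.instance Definition _ :=
  GRing.Additive.copy extend (tensor_lift extend_balanced).

Fact extend_scalable : scalable extend.
Proof.
move=> b; elim/tensor_ind=> [|x y IHx IHy|x v].
- by rewrite scaler0 raddf0 scaler0.
- by rewrite scalerBr !raddfB /= IHx IHy.
- by rewrite tensor_scaleE !extendE scalerA.
Qed.

HB.instance Definition _ :=
  GRing.isScalable.Build B (tensor iota V) X _ extend extend_scalable.
End Extend.

Section Restrict.
Variables (X Y : lmodType B) (g : {linear X -> Y}).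

Definition res_lin : resmod X iota -> resmod Y iota := g.
Fact res_lin_linear : linear res_lin.
Proof. by move=> s x y; rewrite /res_lin linearP. Qed.
HB.instance Definition _ := GRing.isLinear.Build S _ _ _ res_lin res_lin_linear.
End Restrict.

Section Unit.
Variables (V : lmodType S) (Y : lmodType B) (h : {linear tensor iota V -> Y}).

Definition unit_lin (v : V) : resmod Y iota := h (tens 1 v).
Fact unit_lin_linear : linear unit_lin.
Proof.
move=> s v w; rewrite /unit_lin tensDr -tensZ mul1r -[iota s]mulr1.
by rewrite -tensor_scaleE linearP.
Qed.
HB.instance Definition _ := GRing.isLinear.Build S V _ _ unit_lin unit_lin_linear.
End Unit.

(** By adjunction, lifting [h] amounts to lifting [unit_lin h] over [S]; [extend] carries the
    solution back. *)
Lemma projective_tensor (V : lmodType S) :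
  projective V -> projective (tensor iota V).
Proof.
move=> V_proj X Y g h g_surj.
have [k kE] := V_proj _ _ (res_lin g) (unit_lin h) g_surj.
exists (extend k) => t; elim/tensor_ind: t => [|x y IHx IHy|x v].
- by rewrite !raddf0.
- by rewrite !raddfB /= IHx IHy.
- rewrite /= extendE linearZ (kE v : g (k v) = h (tens 1 v)) -linearZ.
  by rewrite tensor_scaleE mulr1.
Qed.
End ExtensionOfScalars.

(** * Projectivity of the regular module and of direct sums *)

Section ProjectiveModules.
Variable R : pzRingType.

Definition scale_at (X : lmodType R) (x : X) (r : R^o) : X := (r : R) *: x.
Fact scale_at_linear (X : lmodType R) (x : X) : linear (scale_at x).
Proof. by move=> a r s; rewrite /scale_at scalerDl scalerA. Qed.
HB.instance Definition _ (X : lmodType R) (x : X) :=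
  GRing.isLinear.Build R R^o X _ (scale_at x) (scale_at_linear x).

Lemma projective_regular : projective R^o.
Proof.
move=> X Y g h g_surj; have [x xE] := g_surj (h 1).
by exists (scale_at x) => r; rewrite /= /scale_at linearZ xE -linearZ [_ *: _]mulr1.
Qed.

Lemma projective_prod (P Q : lmodType R) :
  projective P -> projective Q -> projective (P * Q)%type.
Proof.
move=> P_proj Q_proj X Y g h g_surj.
pose hP : P -> Y := fun p => h (p, 0); pose hQ : Q -> Y := fun q => h (0, q).
have hP_lin : linear hP.
  by move=> a x y; rewrite /hP -linearP; congr (h (_, _)); rewrite /= scaler0 addr0.
have hQ_lin : linear hQ.
  by move=> a x y; rewrite /hQ -linearP; congr (h (_, _)); rewrite /= scaler0 addr0.
pose hP' := HB.pack_for {linear P -> Y} hP (GRing.isLinear.Build R P Y _ hP hP_lin).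
pose hQ' := HB.pack_for {linear Q -> Y} hQ (GRing.isLinear.Build R Q Y _ hQ hQ_lin).
have [kP kPE] := P_proj X Y g hP' g_surj.
have [kQ kQE] := Q_proj X Y g hQ' g_surj.
pose k : (P * Q)%type -> X := fun p => kP p.1 + kQ p.2.
have k_lin : linear k.
  by move=> a x y; rewrite /k /= !linearP scalerDr addrACA.
exists (HB.pack_for {linear (P * Q)%type -> X} k
  (GRing.isLinear.Build R (P * Q)%type X _ k k_lin)) => -[p q].
rewrite /= /k linearD kPE kQE /= /hP /hQ -linearD; congr (h (_, _)).
  by rewrite /= addr0.
by rewrite /= add0r.
Qed.
End ProjectiveModules.

(** * Homogeneous components in [D] *)

Section HomogeneousComponents.
Variables (S : pzRingType) (D : connRing S).
Let hD := gdeg_grading D.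

Lemma hcompMr m n (x b : D) : gdeg n b -> hcomp hD (m + n) (x * b) = hcomp hD m x * b.
Proof.
move=> Gb; have [N [Gx _ xE]] := hcompP hD x; rewrite [in LHS]xE [in RHS]xE.
rewrite mulr_suml !raddf_sum mulr_suml; apply: eq_bigr => i _ /=.
rewrite (hcomp_homog hD _ (gdegM (Gx i) Gb)) (hcomp_homog hD _ (Gx i)) eqn_add2r.
by case: ifP => // _; rewrite mul0r.
Qed.

(** This lets [hcomp hD m] be tensored with a left [S]-module. *)
Lemma hcompMgincl m (x : D) s :
  hcomp hD m (x * gincl D s) = hcomp hD m x * gincl D s.
Proof. by rewrite -[m in LHS]addn0; apply/hcompMr/gincl_range; exists s. Qed.

Lemma hcomp_eq0 (x : D) : (forall m, hcomp hD m x = 0) -> x = 0.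
Proof.
by have [N [_ _ xE]] := hcompP hD x => x0; rewrite xE big1.
Qed.

Lemma regularP (z : D) : regular z <-> forall a, z * a = 0 -> a = 0.
Proof.
split=> [z_reg a za|z_reg n a za _]; last exact: z_reg.
have [N [Ga a0 aE]] := hcompP hD a.
(* [gdeg_le] includes degree [N]: its sum has one term more than the decomposition of [a], and that
   term is zero. *)
apply: (z_reg N) => //; exists (hcomp hD ^~ a); split=> //.
by rewrite {1}aE; apply: sum_widen.
Qed.
End HomogeneousComponents.

(** * The sequence [M_*]: complex property and exactness *)

Section Equivalence.
Variables (S : pzRingType) (D : connRing S) (z : D).
Hypotheses (z1 : gdeg 1 z) (zc : central z).
Local Notation A := (quot_ring z1 zc).
Local Notation pi := (quot_pi z1 zc).
Local Notation hD := (gdeg_grading D).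

Section ExtPi.
Variables (V : nat -> gradedMod S) (n : nat).
Local Notation epi := (@ext_pi S D z z1 zc V n).

Lemma ext_pi_surj t : exists u, epi u = t.
Proof.
by case: n t => [|m] t; [exact: (@zquot_pi_surj D z zc t) | exact: tensor_map_surj].
Qed.

Lemma ext_piB x y : epi (x - y) = epi x - epi y.
Proof. by case: n x y => [|m] x y; [exact: rmorphB | exact: raddfB]. Qed.

Lemma ext_pi_z (u : ext D V n) : epi (z *: u) = 0.
Proof.
case: n u => [|m] u; last exact: tensor_map_z.
by apply: (zquot_pi_eq0 zc (z * u)).2; exists u.
Qed.

Lemma ext_pi_eq0 (t : ext D V n) : epi t = 0 -> exists u, t = z *: u.
Proof.
by case: n t => [|m] t; [exact: (zquot_pi_eq0 zc t).1 | exact: tensor_map_eq0].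
Qed.
End ExtPi.

Lemma aug_pi x : aug (pi x) = aug x.
Proof.
have [N [Gx _ xE]] := hcompP hD x; rewrite [in LHS]xE [in RHS]xE !raddf_sum.
apply: eq_bigr => -[[|i] iN] _ /=.
  by rewrite -gincl_aug quot_pi_incl !aug_gincl.
rewrite (aug_pos (Gx i.+1)); apply: (@aug_pos _ _ i).
by exists (hcomp hD i.+1 x).
Qed.

Lemma signz_scale k (X : lmodType D) (x : X) :
  ((-1) ^+ k * z) *: ((-1) ^+ k *: x) = z *: x.
Proof. by rewrite scalerA -mulrA (zc _) mulrA -expr2 sqrr_sign mul1r. Qed.

Lemma signz_eq0 k (X : lmodType D) (x : X) :
  ((-1) ^+ k * z) *: x = 0 -> z *: x = 0.
Proof.
move=> zx; rewrite -[LHS]scale1r -(sqrr_sign D k) expr2 -!scalerA.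
by rewrite [X in _ *: X]scalerA zx scaler0.
Qed.

Variables (P : resolution_data A) (L : lifting_data P).
Local Notation V := (res_V P).
Local Notation N := (Nmod P).
Hypothesis A1_proj : projective (homog A 1).

Lemma delta1E p : delta L 0 p = lift_d L 0 p.1 + z *: p.2.
Proof. by []. Qed.

Lemma deltaE n p : delta L n.+1 p =
  (lift_d L n.+1 p.1 + ((-1) ^+ n.+1 * z) *: p.2, lift_d L n p.2 + lift_f L n p.1).
Proof. by []. Qed.

Lemma Nmod_projective n : projective (N n).
Proof.
case: n => [|[|m]]; first exact: projective_regular.
  exact: (@projective_tensor S D (gincl D) (homog A 1) A1_proj).
exact: (@projective_tensor S D (gincl D) (res_W P m) (@res_W_proj _ _ P m)).
Qed.

Lemma Mmod_projective n : projective (Mmod P n).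
Proof.
case: n => [|n]; first exact: (@Nmod_projective 0%N).
exact: (projective_prod (@Nmod_projective n.+1) (@Nmod_projective n)).
Qed.

Lemma Nmod_regular n (x : N n) :
  (forall a : D, z * a = 0 -> a = 0) -> z *: x = 0 -> x = 0.
Proof.
case: n x => [|[|m]] x z_reg; first exact: z_reg.
  exact: (@tensor_regular S D (gincl D) (homog A 1) z x A1_proj z_reg).
exact: (@tensor_regular S D (gincl D) (res_W P m) z x (@res_W_proj _ _ P m) z_reg).
Qed.

(** [M_0] has no second summand to hold the obstruction, and the defining relation of [f] cancels
    the rest. *)
Lemma delta_delta1 x : delta L 0 (delta L 1 x) = 0.
Proof.
case: x => x y; rewrite deltaE delta1E /= linearD linearZ_LR lift_dd expr1 mulN1r.
by rewrite scalerDr !scaleNr -opprD [X in _ + X]addrC addNr.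
Qed.

(** Rewriting either pair in [∂ ∂ ∂ x] gives a multiple of [z f ∂ x] or of [z ∂ f x], with opposite
    signs. *)
Lemma lift_df_torsion n (x : N n.+3) :
  z *: (lift_d L n (lift_f L n.+1 x) + lift_f L n (lift_d L n.+2 x)) = 0.
Proof.
apply: (@signz_eq0 n.+1); rewrite scalerDr -lift_dd [lift_d L n.+1 _]lift_dd linearZ_LR.
by rewrite [(-1) ^+ n.+2]exprS mulN1r mulNr scaleNr addrN.
Qed.

Lemma delta_delta n x : (forall a : D, z * a = 0 -> a = 0) ->
  delta L n (delta L n.+1 x) = 0.
Proof.
move=> z_reg; case: n x => [|n] x; first exact: delta_delta1.
case: x => x y; rewrite !deltaE /=; congr (_, _).
  rewrite linearD linearZ_LR lift_dd scalerDr [(-1) ^+ n.+2]exprS mulN1r mulNr.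
  by rewrite !scaleNr -opprD [X in _ + X]addrC addNr.
(* The terms in [y] cancel by the choice of [f], which leaves the obstruction in [x]. *)
rewrite !linearD linearZ_LR lift_dd [(-1) ^+ n.+2]exprS mulN1r mulNr scaleNr.
rewrite [X in _ + X]addrC addrACA subrr add0r.
exact: (Nmod_regular z_reg (lift_df_torsion x)).
Qed.


(** The exponent [0] fits the unsigned formula of [delta L 0] into the general pattern. *)
Lemma delta_fst n x (y : N n) :
  (delta L n (x, y) = 0 -> lift_d L n x + ((-1) ^+ n * z) *: y = 0).
Proof. by case: n x y => [|n] x y; [rewrite expr0 mul1r | case]. Qed.

(* Reduction modulo [z] and exactness of the resolution over [A] make the first
   component of a cycle a boundary. *)
Lemma lift_d_cycle n x (y : N n) : lift_d L n x + ((-1) ^+ n * z) *: y = 0 ->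
  exists p y', (x, y) = delta L n.+1 p + (0, y').
Proof.
move=> xy0; have dx : res_d P n (@ext_pi S D z z1 zc V n.+1 x) = 0.
  rewrite -(lift_d_pi L) (canRL (addrK _) xy0) add0r -scaleN1r scalerA.
  by rewrite mulrA -zc -scalerA ext_pi_z.
have [_ _ /(_ n (ext_pi z1 zc x))[/(_ dx)[t tE] _]] := res_exact P.
have [w wE] := ext_pi_surj t.
have [|u uE] := @ext_pi_eq0 V n.+1 (x - lift_d L n.+1 w).
  by rewrite ext_piB (lift_d_pi L) wE tE subrr.
(* The sign on [u] undoes the one in [delta]; the remainder [y'] absorbs the second component. *)
exists (w, (-1) ^+ n.+1 *: u), (y - (delta L n.+1 (w, (-1) ^+ n.+1 *: u)).2).
rewrite deltaE /=; congr (_, _); last by rewrite /= addrC subrK.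
by rewrite /= addr0 signz_scale -uE addrC subrK.
Qed.

Lemma delta_exact n : (forall a : D, z * a = 0 -> a = 0) ->
  exact_at (delta L n.+1) (delta L n).
Proof.
move=> z_reg [x y]; split=> [xy0|[p <-]]; last exact: delta_delta.
have [p [y' pE]] := lift_d_cycle (delta_fst xy0); exists p.
suff -> : (x, y) = delta L n.+1 p + (0, 0) by rewrite addr0.
rewrite pE; congr (_ + (_, _)); apply: (Nmod_regular z_reg).
(* What is left after subtracting the boundary is still a cycle, and its first component is [z y']
   up to sign. *)
have y'0 : delta L n (0, y') = 0.
  by move: xy0; rewrite pE linearD delta_delta // add0r.
by apply: (@signz_eq0 n); have := delta_fst y'0; rewrite linear0 add0r.
Qed.

(** The section [lift_sigma] takes values in degree one, where the augmentation vanishes. *)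
Lemma aug_lift_d x : aug (lift_d L 0 x) = 0.
Proof.
elim/tensor_ind: x => [|x y IHx IHy|x a]; first by rewrite !raddf0.
  by rewrite linearB raddfB /= IHx IHy subrr.
rewrite lift_d1 rmorphM /= (@aug_pos _ _ 0%N (hval (lift_sigma L a))) ?mulr0 //.
exact: homogP.
Qed.

(** Exactness over [A] gives a preimage up to a multiple of [z], which the second summand of [M_1]
    supplies. *)
Lemma delta0_exact : exact_at (delta L 0) (delta0 P).
Proof.
move=> x; split=> [x0|[[p q] <-]].
  have pix0 : aug (pi x) = 0 by rewrite aug_pi.
  have [_ /(_ (pi x))[/(_ pix0)[t tE] _] _] := res_exact P.
  have [w wE] := @ext_pi_surj V 1%N t.
  have [|u uE] := @ext_pi_eq0 V 0%N (x - lift_d L 0 w).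
    by rewrite ext_piB (lift_d_pi L) wE tE subrr.
  by exists (w, u); rewrite delta1E /= -uE addrC subrK.
rewrite delta1E /= /augl rmorphD rmorphM /= aug_lift_d.
by rewrite (aug_pos z1) mul0r addr0.
Qed.

Lemma regular_resolution : (forall a : D, z * a = 0 -> a = 0) ->
  projective_resolution (delta L) (delta0 P).
Proof.
move=> z_reg; split; first exact: Mmod_projective.
split=> [s||n]; last 2 first; [exact: delta0_exact | exact: delta_exact|].
by exists (gincl D s); exact: (@aug_gincl S D s).
Qed.

(** * Regularity from exactness in low degrees *)

Lemma hcomp0_lift_d x : hcomp hD 0 (lift_d L 0 x) = 0.
Proof. by rewrite -gincl_aug aug_lift_d rmorph0. Qed.

Lemma hcompS_lift_d m (x : tensor (gincl D) (homog A 1)) :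
  hcomp hD m.+1 (lift_d L 0 x) = lift_d L 0 (tensor_end (hcompMgincl m) x).
Proof.
elim/tensor_ind: x => [|x y IHx IHy|x a]; first by rewrite !raddf0.
  by rewrite !linearB !raddfB /= IHx IHy.
by rewrite tensor_endE !lift_d1 -addn1 hcompMr //; exact: homogP.
Qed.

Lemma ann_lift_d (a : D) : trunc_complex (delta L) 2 ->
  (forall y, delta L 0 y = 0 -> exists x, delta L 1 x = y) ->
  z * a = 0 -> exists2 y, z *: y = 0 & lift_d L 0 y = a.
Proof.
move=> cplx exact1 za.
have [|[x y] xyE] := exact1 (0, a); first by rewrite delta1E /= linear0 add0r.
(* [(x, y)] need not be a cycle, but [lift_d_cycle] only asks that the first component of its image
   vanish. *)
have dx0 : lift_d L 1 x + ((-1) ^+ 1 * z) *: y = 0 by case: xyE.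
have [p [y' pE]] := lift_d_cycle dx0.
have : delta L 1 (0, y') = (0, a) by rewrite -xyE pE linearD cplx // add0r.
rewrite deltaE /= !linear0 add0r addr0 => -[/signz_eq0 zy' <-].
by exists y'.
Qed.

Lemma exact1_regular : trunc_complex (delta L) 2 ->
  (forall y, delta L 0 y = 0 -> exists x, delta L 1 x = y) ->
  forall a : D, z * a = 0 -> a = 0.
Proof.
move=> cplx exact1 a za; apply: hcomp_eq0 => m.
(* The induction runs over all annihilators at once: [IHm] is applied to the coordinates of [y], not
   to [a]. *)
elim: m a za => [|m IHm] a /(ann_lift_d cplx exact1)[y zy <-].
  exact: hcomp0_lift_d.
by rewrite hcompS_lift_d (tensor_end_eq0 _ A1_proj IHm zy) linear0.
Qed.

End Equivalence.

Theorem theorem3p12 (S : pzRingType) (D : connRing S)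
    (D_strong : strongly_graded D)
    (z : D) (z1 : gdeg 1 z) (zc : central z)
    (A1_proj : projective (homog (quot_ring z1 zc) 1))
    (P : resolution_data (quot_ring z1 zc)) (L : lifting_data P) :
  [<-> regular z;
       projective_resolution (delta L) (delta0 P);
       trunc_complex (delta L) 2 /\
       (forall h : homology (delta L 1) (delta L 0), h = 0)].
Proof.
tfae.
- by move=> /regularP z_reg; exact: regular_resolution.
- move=> [_ [_ _ ex]]; split=> [n _ x|]; first by apply/ex; exists x.
  by apply/homology_eq0 => y /ex.
- move=> [cplx /homology_eq0 exact1]; apply/regularP.
  exact: (exact1_regular A1_proj cplx exact1).
Qed.
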